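(* Let $q$ be an odd prime power. For every $\varepsilon>0$ there are infinitely many natural numbers $Q$ such that, for a suitable $N\in\mathbb{N}$ and a suitable sequence $(a_g)_{g\in\mathbb{F}_q[t]}$ of complex numbers, \[ \sum_{\substack{f\in\mathbb{F}_q[t]\\ \deg f\le Q\\ f \text{ monic}}}\ \sum_{\substack{r \bmod f^2\\ (r,f)=1}}\Bigg|\sum_{\substack{g\in\mathbb{F}_q[t]\\ \deg g\le N}} a_g\, e\Big(g\cdot\frac{r}{f^2}\Big)\Bigg|^2 \ \ge\ \frac{q^{\mu Q}}{2}\left(q^{N+1}+q^{3Q-1}\right)\sum_{\substack{g\in\mathbb{F}_q[t]\\ \deg g\le N}}|a_g|^2, \] where $\mu:=\dfrac{\log_q 2}{\log_q((1+\varepsilon)Q)}$.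
   Context: $\mathbb{F}_q$ is the finite field with $q$ elements, of characteristic $p$, and $\mathrm{Tr}:\mathbb{F}_q\to\mathbb{F}_p$ is the trace. $\mathbb{F}_q(t)_\infty=\mathbb{F}_q((1/t))$ with absolute value $|0|_\infty=0$ and $|\sum_{i\le n}a_it^i|_\infty=q^n$ if $a_n\ne0$. The additive character $e:\mathbb{F}_q(t)_\infty\to\mathbb{C}^\times$ is $e(\sum_{i\le n}a_it^i)=\exp\!\big(\tfrac{2\pi i}{p}\mathrm{Tr}(a_{-1})\big)$; in particular $e$ is trivial on $\mathbb{F}_q[t]$, so $e(gr/f^2)$ depends only on $r$ modulo $f^2$. The inner sum over $r$ runs over residue classes modulo $f^2$ coprime to $f$. *)

(* Defs.v *)
From HB Require Import structures.
From mathcomp Require Import all_boot all_order all_algebra all_field.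
From mathcomp Require Import all_classical all_reals all_analysis.
From mathcomp Require Import complex zify.

Set Implicit Arguments.
Unset Strict Implicit.
Unset Printing Implicit Defensive.

Import Order.TTheory GRing.Theory Num.Theory.

Local Open Scope classical_set_scope.
Local Open Scope ring_scope.

(* The field F((1/t)) of Laurent series in 1/t: [lcoef x k] is the coefficient
   of t^k in [x], which vanishes for all large k. *)

Record laurent (F : fieldType) := Laurent {
  lcoef : int -> F;
  lcoefP : exists n : int, forall k, n < k -> lcoef k = 0 }.

HB.instance Definition _ (F : fieldType) := gen_eqMixin (laurent F).
HB.instance Definition _ (F : fieldType) := gen_choiceMixin (laurent F).

Section LaurentRing.
Variable F : fieldType.
Implicit Types (x y z : laurent F) (k m n : int).

Definition lbound x n := forall k, n < k -> lcoef x k = 0.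

Lemma laurentP x y : lcoef x =1 lcoef y -> x = y.
Proof.
case: x y => [x hx] [y hy] /= /funext xy; move: hx hy; rewrite xy => hx hy.
by congr Laurent; exact: Prop_irrelevance.
Qed.

Lemma lboundW m n x : m <= n -> lbound x m -> lbound x n.
Proof. by move=> mn xm k /(le_lt_trans mn)/xm. Qed.

Lemma lbound2 x y : exists2 n, lbound x n & lbound y n.
Proof.
have [[m xm] [n yn]] := (lcoefP x, lcoefP y).
exists (Num.max m n); [apply: (lboundW _ xm) | apply: (lboundW _ yn)];
  by rewrite le_max lexx ?orbT.
Qed.

Fact lzero_subproof : exists n : int, forall k, n < k -> 0 = 0 :> F.
Proof. by exists 0. Qed.
Definition lzero := Laurent lzero_subproof.

Fact lopp_subproof x : exists n : int, forall k, n < k -> - lcoef x k = 0.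
Proof. by have [n xn] := lcoefP x; exists n => k /xn->; rewrite oppr0. Qed.
Definition lopp x := Laurent (lopp_subproof x).

Fact ladd_subproof x y :
  exists n : int, forall k, n < k -> lcoef x k + lcoef y k = 0.
Proof.
by have [n xn yn] := lbound2 x y; exists n => k nk; rewrite xn ?yn ?addr0.
Qed.
Definition ladd x y := Laurent (ladd_subproof x y).

Fact laddA : associative ladd.
Proof. by move=> x y z; apply: laurentP => k /=; rewrite addrA. Qed.
Fact laddC : commutative ladd.
Proof. by move=> x y; apply: laurentP => k /=; rewrite addrC. Qed.
Fact ladd0 : left_id lzero ladd.
Proof. by move=> x; apply: laurentP => k /=; rewrite add0r. Qed.
Fact laddN : left_inverse lzero lopp ladd.
Proof. by move=> x; apply: laurentP => k /=; rewrite addNr. Qed.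

HB.instance Definition _ :=
  GRing.isZmodule.Build (laurent F) laddA laddC ladd0 laddN.

(* Only finitely many terms of the sum over all integers are nonzero. *)
Definition lmul_coef x y k : F :=
  \sum_(i \in [set: int]) lcoef x i * lcoef y (k - i).

Lemma lmul_coefE m n x y (j : nat) : lbound x m -> lbound y n ->
  lmul_coef x y (m + n - j%:Z) =
  \sum_(i < j.+1) lcoef x (m - i%:Z) * lcoef y (n - (j - i)%N%:Z).
Proof.
move=> xm yn; pose h (i : nat) : int := m - i%:Z.
have hI : {in `I_j.+1 &, injective h}.
  by move=> a b _ _; rewrite /h => /addrI/oppr_inj[].
rewrite (fsbig_ord _ j.+1
  (fun i => lcoef x (m - i%:Z) * lcoef y (n - (j - i)%N%:Z))).
transitivity (\sum_(i \in h @` `I_j.+1) lcoef x i * lcoef y (m + n - j%:Z - i)).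
  apply/esym/fsbig_widen => // i [_ /= hi].
  have [/xm->|im] := ltP m i; first by rewrite mul0r.
  rewrite [X in _ * X]yn ?mulr0//; rewrite ltNge; apply/negP => ni.
  by apply: hi; exists `|m - i|%N; rewrite /h /=; lia.
rewrite fsbig_image//; apply: eq_fsbigr => i /set_mem /= ij.
by congr (_ * lcoef y _); rewrite /h; lia.
Qed.

Lemma lmul_coef0 m n x y k : lbound x m -> lbound y n -> m + n < k ->
  lmul_coef x y k = 0.
Proof.
move=> xm yn mnk; apply: fsbig1 => i _; have [/xm->|im] := ltP m i.
  by rewrite mul0r.
by rewrite [X in _ * X]yn ?mulr0//; lia.
Qed.

Fact lmul_subproof x y : exists n : int, forall k, n < k -> lmul_coef x y k = 0.
Proof.
have [[m xm] [n yn]] := (lcoefP x, lcoefP y).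
by exists (m + n) => k; exact: lmul_coef0.
Qed.
Definition lmul x y := Laurent (lmul_subproof x y).

Definition lpoly_coef (p : {poly F}) k : F := if k is Posz i then p`_i else 0.
Fact lpoly_subproof p : exists n : int, forall k, n < k -> lpoly_coef p k = 0.
Proof.
exists (size p)%:Z => -[i|//] /= pi; rewrite nth_default//; lia.
Qed.
Definition lpoly p := Laurent (lpoly_subproof p).

Definition lwin x m L : {poly F} := \poly_(i < L) lcoef x (m - i%:Z).

Lemma lmul_bound m n x y : lbound x m -> lbound y n -> lbound (lmul x y) (m + n).
Proof. by move=> xm yn k; exact: lmul_coef0. Qed.

Lemma lmul_win m n x y (j L : nat) : lbound x m -> lbound y n -> (j < L)%N ->
  lcoef (lmul x y) (m + n - j%:Z) = (lwin x m L * lwin y n L)`_j.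
Proof.
move=> xm yn jL; rewrite /= lmul_coefE// coefM; apply: eq_bigr => i _.
have ij := ltn_ord i; by rewrite !coef_poly !ifT //; lia.
Qed.

Lemma lmul_ext m x y : lbound x m -> lbound y m ->
  (forall j : nat, lcoef x (m - j%:Z) = lcoef y (m - j%:Z)) -> x = y.
Proof.
move=> xm ym xy; apply: laurentP => k; have [mk|km] := ltP m k.
  by rewrite xm ?ym.
by have -> : k = m - `|m - k|%N%:Z by lia.
Qed.

Fact lmulA : associative lmul.
Proof.
move=> x y z; have [[m xm] [[n yn] [p zp]]] := (lcoefP x, (lcoefP y, lcoefP z)).
have xy := lmul_bound xm yn; have yz := lmul_bound yn zp.
apply: (@lmul_ext (m + n + p)); first by rewrite -addrA; exact: lmul_bound.
  exact: lmul_bound.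
move=> j; rewrite -[m + n + p in LHS]addrA (lmul_win xm yz (ltnSn j)).
rewrite (lmul_win xy zp (ltnSn j)).
transitivity ((lwin x m j.+1 * lwin y n j.+1 * lwin z p j.+1)`_j).
  rewrite -mulrA !coefM; apply: eq_bigr => i _; congr (_ * _).
  have ij := ltn_ord i; rewrite coef_poly ifT; last by lia.
  by rewrite (@lmul_win _ _ _ _ _ j.+1)//; lia.
rewrite !coefM; apply: eq_bigr => i _; congr (_ * _).
by rewrite [RHS]coef_poly ifT ?ltn_ord// (lmul_win xm yn (ltn_ord i)).
Qed.

Fact lmulC : commutative lmul.
Proof.
move=> x y; have [[m xm] [n yn]] := (lcoefP x, lcoefP y).
apply: (@lmul_ext (m + n)); first exact: lmul_bound.
  by rewrite addrC; exact: lmul_bound.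
move=> j; rewrite (lmul_win xm yn (ltnSn j)) mulrC.
by rewrite [m + n]addrC (lmul_win yn xm (ltnSn j)).
Qed.

Fact lmulDl : left_distributive lmul +%R.
Proof.
move=> x y z; have [m xm ym] := lbound2 x y; have [n zn] := lcoefP z.
have xym : lbound (x + y) m by move=> k mk /=; rewrite xm ?ym ?addr0.
apply: (@lmul_ext (m + n)); first exact: lmul_bound.
  by move=> k mk /=; rewrite !(@lmul_coef0 m n) ?addr0.
move=> j; rewrite [RHS]/= !(@lmul_coefE m n)// -big_split/=.
by rewrite lmul_coefE//; apply: eq_bigr => i _; rewrite /= mulrDl.
Qed.

Fact lmul1 : left_id (lpoly 1) lmul.
Proof.
move=> x; apply: laurentP => k /=; rewrite /lmul_coef.
rewrite -(@fsbig_widen _ _ _ _ [set (0 : int)]) => [|//|].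
  by rewrite fsbig_set1/= coef1 mul1r subr0.
by move=> [[|i]|i] [_ /= h]; rewrite ?coef1 ?mul0r//; case: h.
Qed.

Fact l1_neq0 : lpoly 1 != 0.
Proof.
apply/eqP => /(congr1 (fun x => lcoef x 0))/=; rewrite coef1.
exact/eqP/oner_neq0.
Qed.

HB.instance Definition _ := GRing.Zmodule_isComNzRing.Build (laurent F)
  lmulA lmulC lmul1 lmulDl l1_neq0.

Fixpoint linv_seq (u : nat -> F) (j : nat) : seq F :=
  if j is j'.+1 then let s := linv_seq u j' in
    rcons s ((u 0)^-1 * ((j' == 0)%:R - \sum_(i < j') s`_i * u (j' - i)%N))
  else [::].

Lemma size_linv_seq u j : size (linv_seq u j) = j.
Proof. by elim: j => //= j IH; rewrite size_rcons IH. Qed.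

Lemma nth_linv_seq u j l : (j < l)%N ->
  (linv_seq u l)`_j = (linv_seq u j.+1)`_j.
Proof.
elim: l => // l IH; rewrite ltnS leq_eqVlt => /predU1P[->//|jl].
by rewrite -IH// [linv_seq u l.+1]/= nth_rcons size_linv_seq jl.
Qed.

Lemma linv_seqP u j : u 0 != 0 ->
  \sum_(i < j.+1) (linv_seq u i.+1)`_i * u (j - i)%N = (j == 0)%:R.
Proof.
move=> u0; rewrite big_ord_recr/= subnn nth_rcons size_linv_seq ltnn eqxx.
rewrite mulrAC mulVf// mul1r; under eq_bigr => i _.
  rewrite -[rcons _ _]/(linv_seq u i.+1) -(nth_linv_seq _ (ltn_ord i)); over.
by rewrite addrC subrK.
Qed.

Lemma lmulV_ex x : x != 0 -> exists y, y * x = 1.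
Proof.
move=> x0; have [n xn xn0] : exists2 n, lbound x n & lcoef x n != 0.
  have [m xm] := lcoefP x.
  have ex : exists j : nat, lcoef x (m - j%:Z) != 0.
    apply: contrapT => /forallNP h; case/eqP: x0; apply: (lmul_ext xm) => //.
    by move=> j; apply/eqP/negPn/negP/h.
  case: (ex_minnP ex) => j xj jmin; exists (m - j%:Z) => // k jk.
  have [mk|km] := ltP m k; first exact: xm.
  apply/eqP/negPn/negP => xk.
  have E : m - `|m - k|%N%:Z = k by lia.
  by have := jmin `|m - k|%N; rewrite E => /(_ xk); lia.
pose u (i : nat) := lcoef x (n - i%:Z).
pose v (i : nat) := (linv_seq u i.+1)`_i.
pose c (k : int) := if k <= - n then v `|- n - k|%N else 0.
have cn : forall k, - n < k -> c k = 0 by move=> k nk; rewrite /c leNgt nk.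
pose y := Laurent (ex_intro _ (- n) cn); have yn : lbound y (- n) by [].
have yx : lbound (y * x) 0 by rewrite -[0](addNr n); exact: lmul_bound.
exists y; apply: (lmul_ext yx) => [[[|i]|i] //=|j]; first by rewrite coef1.
rewrite -(addNr n) [LHS](lmul_coefE _ yn xn).
transitivity (\sum_(i < j.+1) v i * u (j - i)%N).
  apply: eq_bigr => i _; congr (_ * _); rewrite /= /c ifT; last by lia.
  by congr v; lia.
rewrite linv_seqP; last by rewrite /u subr0.
by rewrite addNr sub0r; case: j => [|j] /=; rewrite ?coef1.
Qed.

Definition linv x : laurent F := xget 0 [set y | y * x = 1].

Fact lmulV x : x != 0 -> linv x * x = 1.
Proof. by move=> /lmulV_ex[y yx]; rewrite /linv; case: xgetP => // /(_ y). Qed.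

Fact linv0 : linv 0 = 0.
Proof.
rewrite /linv; case: xgetP => // y _ /=; rewrite mulr0 => /esym/eqP.
by rewrite oner_eq0.
Qed.

HB.instance Definition _ :=
  GRing.ComNzRing_isField.Build (laurent F) lmulV linv0.

Lemma lpolyB : zmod_morphism lpoly.
Proof.
by move=> p q; apply: laurentP => -[i|i] /=; rewrite ?coefB ?subr0.
Qed.

Lemma lpolyM : monoid_morphism lpoly.
Proof.
split=> // p q; apply: laurentP => k /=; rewrite /lmul_coef.
have -> : \sum_(i \in [set: int]) lcoef (lpoly p) i * lcoef (lpoly q) (k - i)
    = \sum_(i \in `I_(size p)) p`_i * lpoly_coef q (k - i%:Z).
  transitivity (\sum_(i \in Posz @` `I_(size p))
      lcoef (lpoly p) i * lcoef (lpoly q) (k - i)).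
    apply/esym/fsbig_widen => // -[i|i] [_ /= hi]; rewrite ?mul0r//.
    rewrite nth_default ?mul0r// leqNgt; apply/negP => ip.
    by apply: hi; exists i.
  by rewrite fsbig_image// => i j _ _ [].
rewrite -(fsbig_ord _ _ (fun i => p`_i * _)); case: k => [k|k] /=; last first.
  by apply/esym/big1 => i _; rewrite -[X in _ * X]/(lpoly_coef q _) NegzE;
    case E: (_ - _) => [j|j] /=; rewrite ?mulr0//; lia.
rewrite coefM; have h i : p`_i * lpoly_coef q (k%:Z - i%:Z) =
   if (i < k.+1)%N then p`_i * q`_(k - i) else 0.
  case: ifP => ik; first by have -> : k%:Z - i%:Z = (k - i)%N%:Z by lia.
  case E: (k%:Z - i%:Z) => [j|j] /=; rewrite ?mulr0//; lia.
pose G (i : nat) := if (i < k.+1)%N then p`_i * q`_(k - i) else 0.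
rewrite (eq_bigr (fun i : 'I__ => G i)) => [|i _]; last by rewrite /G ltn_ord.
rewrite [RHS](eq_bigr (fun i : 'I__ => G i)) => [|i _]; last exact: h.
rewrite -[LHS](big_mkord xpredT G) -[RHS](big_mkord xpredT G).
have [pk|kp] := leqP (size p) k.+1.
  rewrite (big_cat_nat (leq0n _) pk)/= [X in _ + X]big_nat_cond.
  rewrite [X in _ + X]big1 ?addr0// => i /andP[/andP[pi _] _].
  by rewrite /G nth_default ?mul0r ?if_same.
rewrite [RHS](big_cat_nat (leq0n _) (ltnW kp))/= [X in _ = _ + X]big_nat_cond.
rewrite [X in _ = _ + X]big1 ?addr0// => i /andP[/andP[ki _] _].
by rewrite /G ltnNge ki.
Qed.

HB.instance Definition _ :=
  GRing.isZmodMorphism.Build {poly F} (laurent F) lpoly lpolyB.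
HB.instance Definition _ :=
  GRing.isMonoidMorphism.Build {poly F} (laurent F) lpoly lpolyM.

Lemma lpoly_inj : injective lpoly.
Proof.
by move=> p q pq; apply/polyP => i; have := congr1 (fun x => lcoef x i%:Z) pq.
Qed.

End LaurentRing.

Notation "p %:L" := (lpoly p) (at level 1, format "p %:L") : ring_scope.

Section Character.
Variables (F : finFieldType) (p : nat) (charFp : p \in [pchar F]).
Let L := pPrimeCharType charFp.

(* [galTrace] takes its values in the prime subfield of F; [absTr] reads them
   in 'F_p, see [absTrE]. *)
Definition absTr (x : F) : 'F_p :=
  odflt 0 [pick c : 'F_p | c%:A == galTrace 1%AS {:L}%AS (x : L)].

Lemma absTrE (x : F) : (absTr x)%:A = galTrace 1%AS {:L}%AS (x : L).
Proof.
rewrite /absTr; case: pickP => [c /eqP//|h].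
have /vlineP[c tc] : galTrace 1%AS {:L}%AS (x : L) \in 1%VS.
  by apply: mem_galTrace; [apply: finField_galois; apply: subvf | exact: memvf].
by have := h c; rewrite tc eqxx.
Qed.

(* exp (2 i pi / p * Tr a_(-1)), the trace being lifted from 'F_p to nat. *)
Definition addchar (R : realType) (x : laurent F) : R[i] :=
  let theta := 2 * pi / p%:R * (nat_of_ord (absTr (lcoef x (-1))))%:R in
  Complex (cos theta) (sin theta).

Let p_gt1 : (1 < p)%N.
Proof. exact: prime_gt1 (pcharf_prime charFp). Qed.

Lemma absTrD : {morph absTr : x y / x + y}.
Proof.
move=> x y; apply: (fmorph_inj (GRing.in_alg L)) => /=.
by rewrite scalerDl !absTrE (raddfD (galTrace 1%AS {:L}%AS)).
Qed.

Section CharacterTheory.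
Variable R : realType.

Let zeta : R[i] := Complex (cos (2 * pi / p%:R)) (sin (2 * pi / p%:R)).

Let zetaX n : zeta ^+ n =
  Complex (cos (2 * pi / p%:R * n%:R)) (sin (2 * pi / p%:R * n%:R)).
Proof.
elim: n => [|n IH]; first by rewrite mulr0 cos0 sin0.
rewrite exprSr IH /zeta; set t := 2 * pi / p%:R; rewrite -natr1 mulrDr mulr1 cosD sinD.
by apply/eqP; rewrite eq_complex /= eqxx /= addrC.
Qed.

Let zetaXp : zeta ^+ p = 1.
Proof.
rewrite zetaX divfK ?pnatr_eq0; last by rewrite -lt0n ltnW.
by rewrite mulr_natl cos2pi sin2pi.
Qed.

Lemma addcharD : {morph @addchar R : x y / x + y >-> x * y}.
Proof.
move=> x y; rewrite /addchar /= -!zetaX -exprD absTrD /=.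
by rewrite expr_mod// Fp_cast ?(pcharf_prime charFp).
Qed.

Lemma addchar_lpoly g : addchar R g%:L = 1.
Proof.
rewrite /addchar /=; have -> : absTr 0 = 0.
  by apply: (addrI (absTr 0)); rewrite -absTrD !addr0.
by rewrite mulr0 cos0 sin0.
Qed.

(* Any set of representatives of the residue classes modulo [m] may be used. *)
Lemma addchar_mod (g r s m : {poly F}) : m != 0 -> r %% m = s %% m ->
  addchar R (g%:L * (r%:L / m%:L)) = addchar R (g%:L * (s%:L / m%:L)).
Proof.
move=> m0 rs; have mL0 : m%:L != 0.
  by rewrite -(rmorph0 (@lpoly F)) (inj_eq (@lpoly_inj F)).
have H u : addchar R (g%:L * (u%:L / m%:L)) =
    addchar R (g%:L * ((u %% m)%:L / m%:L)).
  rewrite {1}(divp_eq u m) rmorphD rmorphM/= mulrDl mulfK// mulrDr addcharD.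
  by rewrite -rmorphM addchar_lpoly mul1r.
by rewrite H rs -H.
Qed.

End CharacterTheory.

End Character.

Definition logb (R : realType) (b x : R) : R := ln x / ln b.

(* Main.v *)
Require Import Defs.
From mathcomp Require Import all_boot all_order all_algebra all_field.
From mathcomp Require Import all_classical all_reals all_analysis.
From mathcomp Require Import complex zify ring.

Import Order.TTheory GRing.Theory Num.Theory.
Local Open Scope classical_set_scope.
Local Open Scope ring_scope.

(* Take Q = q^m, h = t^Q - t and N = 3Q - 2.  Every irreducible factor of h has
   degree at most m, so the squarefree polynomial h has k >= Q / m of them, and
   by the Chinese remainder theorem there are 2^k monic f of degree Q with
   f^2 = 1 mod h.  For r = (f^2 - 1) / h the fraction r / f^2 is at distance
   q^(-3Q) from 1 / h, so with a_g = e(- g / h) the inner sum over g has no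
   cancellation and equals q^(N+1) = q^(3Q-1).  These 2^k fractions already give
   the bound, because log_q ((1 + eps) Q) >= m. *)

(** * Factors of X^(q^m) - X over the field with q elements *)

Section FinitePolynomials.
Variable F : finFieldType.

Let h m : {poly F} := 'X^(#|F| ^ m) - 'X.

Lemma card_exp_gt1 m : (0 < m)%N -> (1 < #|F| ^ m)%N.
Proof. by move=> m0; rewrite -{1}(exp1n m) ltn_exp2r// finNzRing_gt1. Qed.

Lemma pchar_nat_card_exp m : [pchar {poly F}].-nat (#|F| ^ m)%N.
Proof.
have [p p_pr pF] := finPcharP F.
rewrite (card_pprimeChar pF) !pnatX (eq_pnat _ (pchar_poly F)).
by rewrite (eq_pnat _ (pcharf_eq pF)) pnat_id// !orbT.
Qed.

Lemma expf_card_exp m (c : F) : c ^+ (#|F| ^ m) = c.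
Proof. by elim: m => [|m IH]; rewrite ?expr1// expnS exprM expf_card. Qed.

(** The map y -> y^(q^m) is additive and fixes constants, so it sends y(X) to y(X^(q^m)), and
    X^(q^m) is X modulo [h m]. The induction follows Horner's scheme. *)
Lemma dvdp_XnsubX_expsub m (y : {poly F}) : h m %| y ^+ (#|F| ^ m) - y.
Proof.
elim/poly_ind: y => [|y c IH].
  by rewrite expr0n expn_eq0 -leqn0 leqNgt (ltnW (finNzRing_gt1 F)) subrr dvdp0.
rewrite exprDn_pchar ?pchar_nat_card_exp// exprMn -rmorphXn/= expf_card_exp.
set n := (_ ^ _)%N in IH *.
have -> : y ^+ n * 'X^n + c%:P - (y * 'X + c%:P)
    = y ^+ n * ('X^n - 'X) + (y ^+ n - y) * 'X by ring.
by apply: dvdp_add; [exact/dvdp_mull/dvdpp | exact: dvdp_mulr].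
Qed.

Lemma size_XnsubX m : (0 < m)%N -> size (h m) = (#|F| ^ m).+1.
Proof.
move=> m0; rewrite size_polyDl ?size_polyXn// size_polyN size_polyX ltnS.
exact: card_exp_gt1.
Qed.

Lemma monic_XnsubX m : (0 < m)%N -> h m \is monic.
Proof.
move=> m0; rewrite monicE lead_coefDl ?lead_coefXn//.
by rewrite size_polyN size_polyX size_polyXn ltnS card_exp_gt1.
Qed.

(** As q^m vanishes in F, the derivative is the unit -1. Separability later makes the irreducible
    factors pairwise coprime. *)
Lemma separable_XnsubX m : (0 < m)%N -> separable_poly (h m).
Proof.
move=> m0; rewrite unlock derivB derivXn derivX.
have -> : 'X^((#|F| ^ m).-1) *+ (#|F| ^ m) = 0 :> {poly F}.
  rewrite -mulr_natr natrX -[_%:R](rmorph_nat polyC).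
  have [p p_pr pF] := finPcharP F.
  rewrite (card_pprimeChar pF) natrX (pcharf0 pF) expr0n.
  have : (1 < #|F|)%N by exact: finNzRing_gt1.
  rewrite {1}(card_pprimeChar pF).
  by case: logn => // n _; rewrite rmorph0 expr0n -(prednK m0) mulr0.
by rewrite sub0r -scaleN1r coprimepZr ?oppr_eq0 ?oner_eq0// coprimep1.
Qed.

(* The field F[t]/(P) has q^(deg P) elements, all of them roots of X^(q^m) - X. *)
Lemma size_irredp_dvd_XnsubX m (P : {poly F}) : (0 < m)%N ->
  irreducible_poly P -> P \is monic -> P %| h m -> ((size P).-1 <= m)%N.
Proof.
move=> m0 irrP monP Ph; pose hP : monic_irreducible_poly P := (irrP, monP).
pose K := {poly %/ P with hP}; set n := (#|F| ^ m)%N.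
have n1 : (1 < n)%N by exact: card_exp_gt1.
have szK : size ('X^n - 'X : {poly K}) = n.+1.
  by rewrite size_polyDl ?size_polyXn// size_polyN size_polyX ltnS.
have K0 : 'X^n - 'X != 0 :> {poly K} by rewrite -size_poly_eq0 szK.
(* A residue class z is a root because P divides [h m], which divides z^(q^m) - z. *)
have /(max_poly_roots K0) : all (root ('X^n - 'X : {poly K})) (enum K).
  apply/allP => y _; rewrite rootE !hornerE subr_eq0; apply/eqP.
  apply: val_inj; apply: (etrans (poly_of_qpolyX (y : {poly %/ P}) n)).
  have : (size (y : {poly F}) < size P)%N.
    have := size_mk_monic (y : {poly %/ P}).
    by rewrite [in X in (_ < X)%N -> _](mk_monicE hP).
  rewrite /=; move: (polyn y) => z zP.
  rewrite (mk_monicE hP) -(Pdiv.IdomainMonic.modpE monP).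
  have /modp_eq0P := dvdp_trans Ph (dvdp_XnsubX_expsub m z).
  by rewrite modpD modpN -/n (modp_small zP) => /subr0_eq.
rewrite enum_uniq szK -cardE card_qfpoly ltnS => /(_ isT).
by rewrite leq_exp2l// finNzRing_gt1.
Qed.

End FinitePolynomials.

(** * Factorization, and square roots of 1 modulo a separable polynomial *)

Section Polynomials.
Variable F : fieldType.

Lemma monic_prod_irreducible (p : {poly F}) : p \is monic ->
  exists2 s : seq {poly F}, p = \prod_(P <- s) P &
    forall P, P \in s -> irreducible_poly P /\ P \is monic.
Proof.
have [n] := ubnP (size p); elim: n p => // n IH p pn pm.
have [irrp|] := pselect (irreducible_poly p).
  by exists [:: p]; rewrite ?big_seq1// => P; rewrite inE => /eqP->.
have [p1|p1] := leqP (size p) 1.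
  exists [::] => //; rewrite big_nil; apply/eqP.
  by rewrite -eqp_monic ?monic1// -size_poly_eq1 eqn_leq p1 size_poly_gt0 monic_neq0.
move=> /not_andP[//|/existsNP[d /not_implyP[d1 /not_implyP[dp dNp]]]].
have p0 : p != 0 by exact: monic_neq0.
have d0 : d != 0 by exact: dvdpN0 dp p0.
have ld0 : lead_coef d != 0 by rewrite lead_coef_eq0.
(* The proper divisor is made monic, so that its cofactor is monic too and the induction applies to
   both. *)
pose u := (lead_coef d)^-1 *: d.
have um : u \is monic by rewrite monicE lead_coefZ mulVf.
have ud : u %= d by rewrite eqp_scale ?invr_eq0.
have /divpK vup : u %| p by rewrite (eqp_dvdl _ ud).
have su : size u = size d by exact: eqp_size.
have d_lt : (size d < size p)%N.
  rewrite ltn_neqAle dvdp_leq// andbT dvdp_size_eqp//; exact/negP.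
have vm : p %/ u \is monic by rewrite -(monicMr _ um) vup.
have d_gt1 : (1 < size d)%N.
  by rewrite ltn_neqAle eq_sym size_poly_gt0 d0 andbT.
have [|s1 E1 H1] := IH u _ um; first by rewrite su (leq_trans d_lt).
have [|s2 E2 H2] := IH (p %/ u) _ vm.
  rewrite size_divp ?monic_neq0// su.
  have lt_sub a b c : (1 < b -> b < a -> a < c.+1 -> a - b.-1 < c)%N by lia.
  exact: lt_sub d_gt1 d_lt pn.
exists (s2 ++ s1); first by rewrite big_cat/= -E1 -E2 vup.
by move=> P; rewrite mem_cat => /orP[/H2|/H1].
Qed.

(** Chinese remaindering, one factor at a time: separability gives coprimality, and signs square to
    1 modulo every factor. *)
Lemma crt_signs (s : seq {poly F}) (b : nat -> bool) :
  separable_poly (\prod_(P <- s) P) ->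
  exists2 f : {poly F}, \prod_(P <- s) P %| f ^+ 2 - 1 &
    forall i, (i < size s)%N -> s`_i %| f - (-1) ^+ b i.
Proof.
elim: s b => [|P s IH] b.
  by exists 0; rewrite ?big_nil ?dvd1p.
rewrite big_cons separable_mul => /and3P[_ /(IH (b \o succn))].
set M := \prod_(_ <- _) _ => -[f fM fs] /Bezout_eq1_coprimepP[[u v] /= uv].
pose e : {poly F} := (-1) ^+ b 0.
have e2 : e ^+ 2 = 1 by rewrite sqrr_sign.
(* By u P + v M = 1, this g is f modulo M and the sign e modulo P. *)
pose g := f * (u * P) + e * (v * M).
have vM : v * M = 1 - u * P by rewrite -uv addrC addKr.
have uP : u * P = 1 - v * M by rewrite -uv addrK.
have gP : P %| g - e.
  have -> : g - e = (f * u - e * u) * P by rewrite /g vM; ring.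
  exact: dvdp_mulIr.
have gM : M %| g - f.
  have -> : g - f = (e * v - f * v) * M by rewrite /g uP; ring.
  exact: dvdp_mulIr.
exists g; last first.
  move=> [|i] //=; rewrite ltnS => i_s.
  have -> : g - (-1) ^+ b i.+1 = (g - f) + (f - (-1) ^+ b i.+1) by ring.
  rewrite dvdp_add ?fs//; apply: dvdp_trans gM.
  by rewrite /M (big_nth 0) (big_mkord) (bigD1 (Ordinal i_s))//= dvdp_mulIl.
rewrite Gauss_dvdp; last by apply/Bezout_eq1_coprimepP; exists (u, v).
apply/andP; split.
  have -> : g ^+ 2 - 1 = (g - e) * (g + e) by rewrite -e2; ring.
  by rewrite dvdp_mulr.
have -> : g ^+ 2 - 1 = (g - f) * (g + f) + (f ^+ 2 - 1) by ring.
by rewrite dvdp_add ?dvdp_mulr.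
Qed.

(** Turns the degree bound on the irreducible factors of h into a lower bound on their number. *)
Lemma size_monic_prod_le (s : seq {poly F}) (m : nat) :
  (forall P, P \in s -> P \is monic /\ ((size P).-1 <= m)%N) ->
  ((size (\prod_(P <- s) P)%R).-1 <= size s * m)%N.
Proof.
elim: s => [|P s IH] sP; first by rewrite big_nil size_poly1.
have [Pm Pd] := sP P (mem_head _ _).
have {}IH := IH (fun T Ts => sP T (mem_behead (s := P :: s) Ts)).
have sm : \prod_(T <- s) T \is monic.
  rewrite big_seq; apply: monic_prod => T Ts.
  by have [] := sP T (mem_behead (s := P :: s) Ts).
rewrite big_cons size_monicM ?monic_neq0//=.
have sub_le (a b c d : nat) : (a.-1 <= c -> b.-1 <= d -> (a + b).-1.-1 <= c + d)%N.
  by lia.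
exact: sub_le.
Qed.

Lemma sqrt1_mod_family (s : seq {poly F}) (h := \prod_(P <- s) P) :
  2 != 0 :> F -> separable_poly h -> h \is monic -> (1 < size h)%N ->
  (forall P, P \in s -> (1 < size P)%N) ->
  exists2 f : {ffun 'I_(size s) -> bool} -> {poly F}, injective f &
    forall b, [/\ f b \is monic, size (f b) = size h & h %| f b ^+ 2 - 1].
Proof.
move=> two hsep hm h1 sP; have h0 := monic_neq0 hm.
have /choice[g gP] (b : {ffun 'I_(size s) -> bool}) : exists g : {poly F},
    h %| g ^+ 2 - 1 /\ forall i : 'I_(size s), s`_i %| g - (-1) ^+ b i.
  have [g hg sg] := crt_signs _ (fun i => oapp b false (insub i)) hsep.
  by exists g; split=> // i; have := sg i (ltn_ord i); rewrite valK.
(* Reducing modulo h and then adding h keeps the residue class and makes the result monic of the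
   degree of h. *)
pose f b := h + g b %% h.
have fg b : h %| f b - g b.
  have -> : f b - g b = (1 - g b %/ h) * h.
    by rewrite /f {2}(divp_eq (g b) h); ring.
  exact: dvdp_mulIr.
have gh b : (size (g b %% h)%R < size h)%N by rewrite ltn_modp.
exists f => [b c fbc|b]; last first.
  split; [|exact: size_polyDl|].
    by rewrite monicE lead_coefDl// -monicE.
  have -> : f b ^+ 2 - 1 = (f b - g b) * (f b + g b) + (g b ^+ 2 - 1) by ring.
  by apply: dvdp_add; [exact: dvdp_mulr | have [] := gP b].
apply/ffunP => i; apply/eqP; apply: contraT => bci.
have si : s`_i \in s by rewrite mem_nth.
have sih : s`_i %| h.
  by rewrite /h (big_nth 0) big_mkord (bigD1 i)//= dvdp_mulIl.
have [[_ /(_ i) gb] [_ /(_ i) gc]] := (gP b, gP c).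
(* If two sign patterns differing at i gave the same polynomial, the i-th factor would divide 2 or
   -2, a nonzero constant. *)
have : s`_i %| (-1) ^+ b i - (-1) ^+ c i.
  have -> : (-1) ^+ b i - (-1) ^+ c i = (f c - g c) - (f b - g b)
      + (g c - (-1) ^+ c i) - (g b - (-1) ^+ b i) :> {poly F}.
    by rewrite fbc; ring.
  apply: dvdp_sub gb; apply: dvdp_add gc.
  exact: dvdp_trans sih (dvdp_sub (fg c) (fg b)).
have -> : (-1) ^+ b i - (-1) ^+ c i = ((-1) ^+ b i * 2)%:P :> {poly F}.
  move: bci; rewrite polyCM.
  by case: (b i); case: (c i) => //= _; rewrite ?expr1 ?expr0 ?polyCN polyC1;
    rewrite -[2%:P]/((1 + 1)%:P) polyCD polyC1; ring.
move=> /dvdp_leq; rewrite polyC_eq0 mulf_eq0 signr_eq0 (negPf two) => /(_ isT).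
rewrite size_polyC mulf_eq0 signr_eq0 (negPf two) /= leqNgt.
by rewrite sP.
Qed.

(** * Degrees of quotients in F((1/t)) *)

Lemma lpoly_neq0 (f : {poly F}) : f != 0 -> f%:L != 0.
Proof. by move=> f0; rewrite -(rmorph0 (@lpoly F)) (inj_eq (@lpoly_inj F)). Qed.

(** Let y = g / D. If n bounds the degree of y and exceeds the claimed bound, the coefficient of t^n
    in y times the leading coefficient of D is a coefficient of g past its degree, hence zero. So n
    can be lowered by 1 until the bound is reached. *)
Lemma lbound_divl (g D : {poly F}) : D != 0 ->
  Defs.lbound (g%:L / D%:L) ((size g)%:Z - (size D)%:Z).
Proof.
move=> D0; set y := g%:L / D%:L.
have DL0 := lpoly_neq0 _ D0.
have yD : lmul y D%:L = g%:L by rewrite -[LHS]/(y * D%:L) mulfVK.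
have D1 : (0 < size D)%N by rewrite size_poly_gt0.
have DB : Defs.lbound D%:L ((size D).-1)%:Z.
  by move=> [i|//] /= Di; rewrite nth_default//; lia.
(* Ensures that n + deg D is a natural number, at least [size g], so that it indexes a vanishing
   coefficient of g. *)
have nonneg (a b : nat) (n : int) : (0 < b)%N -> a%:Z - b%:Z < n ->
    exists2 j : nat, n + b.-1%:Z = j%:Z & (a <= j)%N.
  by move=> b0 abn; exists `|(n + b.-1%:Z)%R|%N; lia.
have step n : (size g)%:Z - (size D)%:Z < n ->
    Defs.lbound y n -> Defs.lbound y (n - 1).
  move=> gn yn k nk; have [/yn//|kn] := ltP n k.
  have -> : k = n by lia.
  have [j jE gj] := nonneg _ _ _ D1 gn.
  have /eqP := lmul_coefE 0 yn DB; rewrite big_ord1 !subr0.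
  rewrite -[lmul_coef _ _ _]/(lcoef (lmul y D%:L) _) yD /= -lead_coefE.
  rewrite jE /= (nth_default _ gj).
  by rewrite eq_sym mulf_eq0 lead_coef_eq0 (negPf D0) orbF => /eqP.
have [n yn] := lcoefP y.
move: ((size g)%:Z - _) step => B step.
have [nB|/ltW Bn] := leP n B; first exact: lboundW yn.
have [d nd] : exists d : nat, n = B + d%:Z by exists `|(n - B)%R|%N; lia.
elim: d n yn nd {Bn} => [|d IH] n yn nd; first by rewrite -[B]addr0 -nd.
by apply: (IH (n - 1)); [apply: step => //; lia | lia].
Qed.

End Polynomials.

(** * Character sums at fractions close to 1 / h *)

Section Sieve.
Variables (R : realType) (F : finFieldType) (p : nat) (charFp : p \in [pchar F]).
Local Notation normc := ComplexField.Normc.normc.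
Local Notation e := (addchar charFp R).

Lemma addchar_eq1 (x : laurent F) : lcoef x (-1) = 0 -> e x = 1.
Proof. by move=> x0; rewrite -(addchar_lpoly charFp R 0) /addchar x0. Qed.

Lemma normc_addchar (x : laurent F) : normc (e x) = 1.
Proof. by rewrite /addchar /= cos2Dsin2 sqrtr1. Qed.

Lemma normc_natr (n : nat) : normc (n%:R : R[i]) = n%:R.
Proof.
apply: (etrans (normcMn (1 : Rcomplex R) n)).
by congr (_ *+ _); exact: ComplexField.Normc.normc1.
Qed.

(* [r / f ^+ 2 - 1 / h = - 1 / (h * f ^+ 2)] is too small to be seen by [e]. *)
Lemma addchar_near_inv (g h f r : {poly F}) : h != 0 -> f != 0 ->
    r * h = f ^+ 2 - 1 -> ((size g).+1 < size (h * f ^+ 2)%R)%N ->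
  e (- (g%:L / h%:L)) * e (g%:L * (r%:L / (f ^+ 2)%:L)) = 1.
Proof.
move=> h0 f0 rh sg; rewrite -addcharD; apply: addchar_eq1.
have hf0 : h * f ^+ 2 != 0 by rewrite mulf_neq0 ?expf_neq0.
have hL := lpoly_neq0 _ _ h0.
have rhL : r%:L * h%:L = (f ^+ 2)%:L - 1 by rewrite -rmorphM rh rmorphB rmorph1.
have -> : - (g%:L / h%:L) + g%:L * (r%:L / (f ^+ 2)%:L)
    = - (g%:L / (h * f ^+ 2)%:L).
  rewrite [(h * _)%:L]rmorphM /=.
  have -> : r%:L = ((f ^+ 2)%:L - 1) / h%:L by rewrite -rhL mulfK.
  by field; rewrite !lpoly_neq0.
rewrite -[LHS]/(- lcoef (g%:L / (h * f ^+ 2)%:L) (-1)).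
(* The size hypothesis puts the degree of g / (h f^2) below -1, the only exponent that [e] reads. *)
have degB (a b : nat) : (a.+1 < b)%N -> a%:Z - b%:Z < -1 by lia.
by rewrite (lbound_divl _ g _ hf0) ?oppr0//; exact: degB sg.
Qed.

(** All terms are squares, so it is enough to keep one fraction for each [f t]. There all q^n
    summands of the inner sum equal 1. *)
Lemma large_sieve_lower (Q : nat) (h : {poly F}) (T : finType)
    (f : T -> {poly F}) (n := (3 * Q).-1)
    (a := fun g : {poly F} => e (- (g%:L / h%:L))) :
  (0 < Q)%N -> h \is monic -> size h = Q.+1 -> injective f ->
  (forall t, [/\ f t \is monic, size (f t) = Q.+1 & h %| f t ^+ 2 - 1]) ->
  #|T|%:R * (#|F|%:R ^+ n) ^+ 2 <=
  \sum_(f : {poly_Q.+1 F} | (f : {poly F}) \is monic)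
     \sum_(r : {poly_(size ((f : {poly F}) ^+ 2)).-1 F} | coprimep r f)
       normc (\sum_(g : {poly_n F}) a g *
         e ((g : {poly F})%:L *
            ((r : {poly F})%:L / ((f : {poly F}) ^+ 2)%:L))) ^+ 2 :> R.
Proof.
move=> Q0 hm sh f_inj fP.
pose G (f : {poly F}) := \sum_(r : {poly_(size (f ^+ 2)).-1 F} | coprimep r f)
  normc (\sum_(g : {poly_n F}) a g *
    e ((g : {poly F})%:L * ((r : {poly F})%:L / (f ^+ 2)%:L))) ^+ 2.
rewrite [leRHS](_ : _ = \sum_(f : {poly_Q.+1 F} | (f : {poly F}) \is monic) G f)//.
have G0 u : 0 <= G u by apply: sumr_ge0 => r _; exact: sqr_ge0.
have Gf t : (#|F|%:R ^+ n) ^+ 2 <= G (f t).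
  have [fm sf hf] := fP t; have h0 := monic_neq0 hm; have f0 := monic_neq0 fm.
  have sf2 : size (f t ^+ 2) = (2 * Q).+1.
    by rewrite expr2 size_monicM// sf; lia.
  have rh : (f t ^+ 2 - 1) %/ h * h = f t ^+ 2 - 1 by exact: divpK.
  have sr : (size ((f t ^+ 2 - 1)%R %/ h)%R <= (size (f t ^+ 2)%R).-1)%N.
    rewrite size_divp// size_polyDl; last first.
      by rewrite size_polyN size_poly1 sf2; lia.
    by rewrite sf2 sh; lia.
  rewrite /G (bigD1 (npolyp _ ((f t ^+ 2 - 1) %/ h))) /=; last first.
    (* Coprimality of r and f comes from f * f - h * r = 1. *)
    rewrite npolypK//; apply/Bezout_eq1_coprimepP.
    by exists (- h, f t) => /=; rewrite mulNr mulrC rh; ring.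
  rewrite npolypK// ler_wpDr//; first by apply: sumr_ge0 => r _; exact: sqr_ge0.
  rewrite (eq_bigr (fun=> 1)) => [|g _]; last first.
    apply: addchar_near_inv => //.
    (* The size of h f^2 is 3Q + 1, so n = 3Q - 1 is the largest value allowed by n + 1 < 3Q + 1. *)
    rewrite size_monicM ?expf_neq0// sh sf2.
    apply: (@leq_ltn_trans n.+1); first by rewrite ltnS size_npoly.
    by rewrite /n; lia.
  by rewrite sumr_const normc_natr -[#|_|]/#|{poly_n F}| card_npoly natrX.
pose k t : {poly_Q.+1 F} := npolyp Q.+1 (f t).
have kE t : k t = f t :> {poly F} by rewrite npolypK//; have [_ -> _] := fP t.
have k_inj : injective k.
  by move=> s t st; apply: f_inj; rewrite -!kE st.
apply: (@le_trans _ _ (\sum_(u in [set k t | t : T]) G u)).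
  rewrite big_imset/=; last by move=> s t _ _; exact: k_inj.
  rewrite mulr_natl -sumr_const; apply: ler_sum => t _; rewrite kE.
  exact: Gf.
rewrite big_mkcond [leRHS]big_mkcond; apply: ler_sum => u _.
case: ifPn => [/imsetP[t _ ->]|_]; last by case: ifP.
by rewrite kE; have [-> _ _] := fP t.
Qed.

End Sieve.

(** * The factor q^(mu Q), and the conclusion *)

Lemma exp2_divisor_bound (R : realType) (q m k : nat) (eps : R) (Q := (q ^ m)%N) :
  0 < eps -> (1 < q)%N -> (0 < m)%N -> (Q <= k * m)%N ->
  q%:R `^ (logb q%:R 2 / logb q%:R ((1 + eps) * Q%:R) * Q%:R) <= 2 ^+ k :> R.
Proof.
move=> eps0 q1 m0 Qk.
have q0 : 0 < q%:R :> R by rewrite ltr0n ltnW.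
have lq : 0 < ln q%:R :> R by rewrite ln_gt0// ltr1n.
have l2 : 0 < ln 2 :> R by rewrite ln_gt0// ltr1n.
have Q0 : 0 < Q%:R :> R by rewrite ltr0n expn_gt0 ltnW.
have lQ : ln Q%:R = m%:R * ln q%:R :> R by rewrite natrX lnXn// mulr_natl.
have LQ : m%:R * ln q%:R <= ln ((1 + eps) * Q%:R).
  rewrite -lQ ler_ln ?posrE//; last by rewrite mulr_gt0// addr_gt0.
  by rewrite ler_peMl ?(ltW Q0)// lerDl ltW.
have L0 : 0 < ln ((1 + eps) * Q%:R).
  by apply: lt_le_trans LQ; rewrite mulr_gt0// ltr0n.
rewrite -powR_mulrn// /powR (gt_eqF q0) pnatr_eq0 /= ler_expR /logb.
set L := ln ((1 + eps) * _) in LQ L0 *.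
(* The power of q becomes 2 to the exponent Q / log_q ((1 + eps) Q), which is at most Q / m <= k. *)
have -> : ln 2 / ln q%:R / (L / ln q%:R) * Q%:R * ln q%:R
    = ln 2 * (Q%:R * ln q%:R / L) :> R.
  by field; rewrite !gt_eqF.
rewrite mulrC ler_pM2r// ler_pdivrMr//.
apply: (@le_trans _ _ (k%:R * (m%:R * ln q%:R))); last by rewrite ler_wpM2l.
by rewrite mulrA ler_pM2r// -natrM ler_nat.
Qed.

Theorem theorem3p1 (R : realType) (F : finFieldType) (p : nat)
    (charFp : p \in [pchar F]) (q_odd : odd #|F|) (eps : R) (eps_gt0 : 0 < eps) :
  let q : R := #|F|%:R in
  infinite_set [set Q : nat |
    let mu : R := logb q 2 / logb q ((1 + eps) * Q%:R) in
    exists (N : nat) (a : {poly F} -> R[i]),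
      (exists g : {poly_N.+1 F}, a g != 0) /\
      q `^ (mu * Q%:R) / 2 * (q ^ (N%:Z + 1) + q ^ (3 * Q%:Z - 1)) *
        (\sum_(g : {poly_N.+1 F}) ComplexField.Normc.normc (a g) ^+ 2)
      <= \sum_(f : {poly_Q.+1 F} | (f : {poly F}) \is monic)
           \sum_(r : {poly_(size ((f : {poly F}) ^+ 2)).-1 F} | coprimep r f)
             ComplexField.Normc.normc
               (\sum_(g : {poly_N.+1 F})
                  a g * addchar charFp R
                    ((g : {poly F})%:L *
                     ((r : {poly F})%:L / ((f : {poly F}) ^+ 2)%:L))) ^+ 2].
Proof.
move=> q; have F1 := finNzRing_gt1 F.
(* Exponents start at 1, so that Q > 1 and h is monic of degree Q. *)
have pow_inj : injective (fun m => #|F| ^ m.+1)%N.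
  by move=> i j /= /eqP; rewrite eqn_exp2l// => /eqP[].
apply: (@sub_infinite_set _ (range (fun m => #|F| ^ m.+1)%N)); last first.
  rewrite (eq_finite_set (inj_card_eq _)); last first.
    by move=> i j _ _; exact: pow_inj.
  exact: infinite_nat.
move=> _ [m _ <-]; set Q := (_ ^ _)%N => mu.
have Q1 : (1 < Q)%N by exact: card_exp_gt1.
have hm := monic_XnsubX F m.+1 isT; have sh := size_XnsubX F m.+1 isT.
have hsep := separable_XnsubX F m.+1 isT.
rewrite -/Q in hm sh hsep.
have [s hs sP] := monic_prod_irreducible _ _ hm.
have two : 2 != 0 :> F.
  apply/negP => two; have c2 : 2 \in [pchar F] by rewrite inE.
  by move: q_odd F1; rewrite (card_pprimeChar c2) oddX orbF => /eqP->.
have Ps P : P \in s -> P \is monic /\ ((size P).-1 <= m.+1)%N.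
  move=> Ps; have [irrP Pm] := sP P Ps; split=> //.
  by apply: size_irredp_dvd_XnsubX => //; rewrite -/Q hs (big_rem P)//= dvdp_mulIl.
have Qk : (Q <= size s * m.+1)%N.
  by have := size_monic_prod_le _ _ _ Ps; rewrite -hs sh.
have [f f_inj fP] : exists2 f : {ffun 'I_(size s) -> bool} -> {poly F},
    injective f & forall b,
    [/\ f b \is monic, size (f b) = Q.+1 & 'X^Q - 'X %| f b ^+ 2 - 1].
  rewrite -sh hs; apply: sqrt1_mod_family; rewrite -?hs ?sh//; first by lia.
  by move=> P /sP[[]].
(* With N = 3Q - 2 the two powers of q in the bound coincide, and their sum absorbs the factor
   1/2. *)
have EN : (3 * Q).-2.+1 = (3 * Q).-1 by lia.
exists (3 * Q).-2, (fun g => addchar charFp R (- (g%:L / ('X^Q - 'X)%:L))).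
split.
  exists 0; apply/eqP => /(congr1 (@ComplexField.Normc.normc R)).
  by rewrite normc_addchar ComplexField.Normc.normc0 => /eqP; rewrite oner_eq0.
have qE1 : q ^ ((3 * Q).-2%:Z + 1) = q ^+ (3 * Q).-1.
  by rewrite exprnP; congr (_ ^ _); lia.
have qE2 : q ^ (3 * Q%:Z - 1) = q ^+ (3 * Q).-1.
  by rewrite exprnP; congr (_ ^ _); lia.
rewrite qE1 qE2 EN.
have Q0 : (0 < Q)%N by lia.
apply: le_trans (large_sieve_lower R F p charFp Q _ _ f Q0 hm sh f_inj fP).
rewrite card_ffun card_bool card_ord (natrX _ 2) -/q.
(* Every coefficient has modulus 1, so the sum of squares counts the q^(3Q-1) polynomials g. *)
under eq_bigr do rewrite normc_addchar expr1n.
rewrite sumr_const -[#|_|]/#|{poly_((3 * Q).-1) F}| card_npoly.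
rewrite (natrX _ _ (3 * Q).-1) -/q.
set X := q ^+ _; rewrite [leLHS](_ : _ = q `^ (mu * Q%:R) * X ^+ 2); last by field.
rewrite ler_wpM2r ?sqr_ge0//.
exact: exp2_divisor_bound.
Qed.
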